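(* Let $\mathfrak{g}$ be a locally finite real Lie algebra which is the directed union of compact simple Lie algebras. Then $\mathfrak{g}$ has an invariant scalar product, which is unique up to a positive constant.
   Context: A Lie algebra is locally finite if every finite subset generates a finite-dimensional Lie subalgebra. A compact simple Lie algebra is a finite-dimensional (non-abelian) simple real Lie algebra which is the Lie algebra of a compact Lie group. An invariant scalar product is a positive definite symmetric bilinear form $\kappa$ on $\mathfrak{g}$ with $\kappa([x,y],z)=\kappa(x,[y,z])$ for all $x,y,z\in\mathfrak{g}$. *)

(* Defs.v *)
From HB Require Import structures.
From mathcomp Require Import all_boot all_order all_algebra.
From mathcomp Require Import all_classical all_reals all_analysis.
Set Implicit Arguments.
Unset Strict Implicit.
Unset Printing Implicit Defensive.
Import Order.TTheory GRing.Theory Num.Theory.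
Import numFieldNormedType.Exports.
Local Open Scope classical_set_scope.
Local Open Scope ring_scope.

HB.mixin Record Lmodule_isLieAlgebra (R : comNzRingType) L
    of GRing.Lmodule R L := {
  lie : L -> L -> L ;
  lie_linearl : forall y, linear (lie^~ y) ;
  lie_linearr : forall x, linear (lie x) ;
  liexx : forall x, lie x x = 0 ;
  lie_jacobi : forall x y z,
    lie x (lie y z) + lie y (lie z x) + lie z (lie x y) = 0
}.

#[short(type="lieAlgType")]
HB.structure Definition LieAlgebra (R : comNzRingType) :=
  {L of GRing.Lmodule R L & Lmodule_isLieAlgebra R L}.

Section LieAlgebraNotions.
Variables (R : comNzRingType) (L : lieAlgType R).
Implicit Types (S K I : set L).

Definition lin_subspace S : Prop :=
  S 0 /\ forall (a : R) x y, S x -> S y -> S (a *: x + y).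

Definition lie_subalgebra S : Prop :=
  lin_subspace S /\ forall x y, S x -> S y -> S (lie x y).

Definition finite_dimensional S : Prop :=
  exists (m : nat) (e : 'I_m -> L),
    S = range (fun a : 'rV[R]_m => \sum_(i < m) a 0 i *: e i).

Definition lie_generated S : set L :=
  \bigcap_(K in [set K | lie_subalgebra K /\ S `<=` K]) K.

Definition locally_finite_lie : Prop :=
  forall S, finite_set S -> finite_dimensional (lie_generated S).

Definition lie_ideal_of K I : Prop :=
  [/\ lin_subspace I, I `<=` K & forall x y, K x -> I y -> I (lie x y)].

Definition simple_lie K : Prop :=
  (exists x y, [/\ K x, K y & lie x y <> 0]) /\
  forall I, lie_ideal_of K I -> I = [set 0] \/ I = K.

End LieAlgebraNotions.

Section Smooth.
Variables (R : realType) (V W : normedModType R).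

(* C^k on an open set U.  For finite-dimensional V, f is C^(k+1) on U iff it
   is differentiable on U and all x |-> 'd f x v are C^k on U. The function f
   is total, but its values outside the open set U are irrelevant. *)
Fixpoint Ck (k : nat) (U : set V) (f : V -> W) : Prop :=
  match k with
  | 0%N => forall x, U x -> {for x, continuous f}
  | k'.+1 => (forall x, U x -> differentiable f x) /\
             forall v : V, Ck k' U (fun x => 'd f x v)
  end.

Definition smooth_on (U : set V) (f : V -> W) : Prop := forall k, Ck k U f.

End Smooth.

(* A homeomorphism from the open set [chart_dom] onto the open set
   [chart_map @` chart_dom] of R^n, with inverse [chart_inv]; [chart_map] and
   [chart_inv] are total functions, arbitrary outside these two sets. *)
Record chart (R : realType) (n : nat) (M : topologicalType) := Chart {
  chart_dom : set M ;
  chart_map : M -> 'rV[R]_n ;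
  chart_inv : 'rV[R]_n -> M ;
  chart_dom_open : open chart_dom ;
  chart_cod_open : open (chart_map @` chart_dom) ;
  chart_mapK : forall p, chart_dom p -> chart_inv (chart_map p) = p ;
  chart_map_continuous : forall p, chart_dom p -> {for p, continuous chart_map} ;
  chart_inv_continuous :
    forall x, (chart_map @` chart_dom) x -> {for x, continuous chart_inv}
}.

Definition chart_cod (R : realType) n (M : topologicalType) (c : chart R n M) :
  set 'rV[R]_n := chart_map c @` chart_dom c.

#[short(type="preTopologicalGroupType")]
HB.structure Definition PreTopologicalGroup :=
  {G of Topological G & monoid.Group G}.

(* Second countability is not required; it holds for compact manifolds. *)
HB.mixin Record isLieGroup (R : realType) (n : nat) G of PreTopologicalGroup G := {
  lie_group_hausdorff : hausdorff_space G ;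
  atlas : set (chart R n G) ;
  atlas_cover : forall g : G, exists2 c, atlas c & chart_dom c g ;
  atlas_smooth : forall c d, atlas c -> atlas d ->
    smooth_on [set x | chart_cod c x /\ chart_dom d (chart_inv c x)]
              (fun x => chart_map d (chart_inv c x)) ;
  mulg_continuous : continuous (fun p : G * G => (p.1 * p.2)%g) ;
  invg_continuous : continuous (fun g : G => (g^-1)%g) ;
  mulg_smooth : forall b c d, atlas b -> atlas c -> atlas d ->
    smooth_on [set p : 'rV[R]_n * 'rV[R]_n | [/\ chart_cod b p.1, chart_cod c p.2
                     & chart_dom d (chart_inv b p.1 * chart_inv c p.2)%g]]
              (fun p => chart_map d (chart_inv b p.1 * chart_inv c p.2)%g) ;
  invg_smooth : forall c d, atlas c -> atlas d ->
    smooth_on [set x | chart_cod c x /\ chart_dom d (chart_inv c x)^-1%g]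
              (fun x => chart_map d (chart_inv c x)^-1%g)
}.

#[short(type="lieGroupType")]
HB.structure Definition LieGroup (R : realType) (n : nat) :=
  {G of PreTopologicalGroup G & isLieGroup R n G}.

Section LieAlgebraOfLieGroup.
Variables (R : realType) (n : nat) (G : lieGroupType R n) (c : chart R n G).

(* The chart c is meant to be around 1; its differential at 1 identifies the
   tangent space T_1 G with R^n. Ad g is the differential at 1 of the
   conjugation h |-> g h g^-1. *)
Definition Ad (g : G) (Y : 'rV[R]_n) : 'rV[R]_n :=
  'D_Y (fun y => chart_map c (g * chart_inv c y * g^-1)%g) (chart_map c 1%g).

(* [X, Y] = (T_1 Ad)(X)(Y) *)
Definition lie_group_bracket (X Y : 'rV[R]_n) : 'rV[R]_n :=
  'D_X (fun x => Ad (chart_inv c x) Y) (chart_map c 1%g).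

End LieAlgebraOfLieGroup.

Section CompactLie.
Variables (R : realType) (L : lieAlgType R).

(* K is isomorphic to T_1 G with its Lie bracket (the isomorphism type does
   not depend on the choice of the chart c around 1). *)
Definition is_lie_algebra_of (K : set L) n (G : lieGroupType R n) : Prop :=
  exists c : chart R n G, [/\ atlas c, chart_dom c 1%g &
    exists f : {linear 'rV[R]_n -> L},
      [/\ injective f, range f = K &
          forall X Y, f (lie_group_bracket c X Y) = lie (f X) (f Y)]].

Definition compact_simple_lie (K : set L) : Prop :=
  [/\ lie_subalgebra K, finite_dimensional K, simple_lie K &
      exists n (G : lieGroupType R n),
        compact [set: G] /\ is_lie_algebra_of K G].

Definition directed_union_of (P : set L -> Prop) : Prop :=
  exists F : set (set L),
    [/\ F !=set0,
        forall K, F K -> P K,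
        forall K1 K2, F K1 -> F K2 ->
          exists2 K3, F K3 & K1 `<=` K3 /\ K2 `<=` K3 &
        \bigcup_(K in F) K = [set: L]].

Definition invariant_scalar_product (kappa : L -> L -> R) : Prop :=
  [/\ (forall x, scalar (kappa x)) /\ (forall y, scalar (kappa^~ y)),
      forall x y, kappa x y = kappa y x,
      forall x, x != 0 -> 0 < kappa x x &
      forall x y z, kappa (lie x y) z = kappa x (lie y z)].

End CompactLie.

(* Main.v *)
From HB Require Import structures.
Require Import Defs.
From mathcomp Require Import all_boot all_order all_algebra.
From mathcomp Require Import all_classical all_reals all_analysis.
From mathcomp Require Import ring lra.

(** Each compact simple Lie algebra K carries an invariant scalar product and
    only one up to a positive constant; on a directed union these forms,
    normalised at one common vector, fit together.

    Existence on K.  Let G be a compact Lie group with Lie algebra K.  The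
    operators Ad(g) form a bounded group of matrices, because g |-> Ad(g) is
    continuous and G is compact ([Ad_mx_bounded]).  A bounded group of matrices
    preserves a positive definite form ([bounded_group_invariant_form]): the
    form is a fixed point of the linear action on
    symmetric matrices, obtained as a circumcenter, that is, as the unique point
    of an invariant closed convex set whose orbit has the smallest radius
    ([bounded_group_fixpoint]).  Differentiating
    S(Ad(g) Y, Ad(g) Z) = S(Y, Z) at g = 1 gives
    S([X, Y], Z) + S(Y, [X, Z]) = 0 ([lie_group_bracket_skew]), which is
    invariance.

    Uniqueness on K.  Given two invariant scalar products kappa and kappa', let
    c be the minimum of kappa'(x, x) / kappa(x, x) over the nonzero x of K.  The
    form kappa' - c kappa is invariant, positive semidefinite, and vanishes at a
    nonzero vector, so its radical is a nonzero ideal of K; as K is simple, the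
    radical is K and kappa' = c kappa
    ([invariant_scalar_product_on_unique]).

    Gluing.  Fix a member K0 of the directed family and a nonzero x0 in K0.  By
    uniqueness, the scalar products of the members K containing K0 that take the
    value 1 at (x0, x0) restrict to one another, hence define a single form on
    the union; any other invariant scalar product kappa' is kappa'(x0, x0) times
    this one. *)

Set Implicit Arguments.
Unset Strict Implicit.
Unset Printing Implicit Defensive.
Import Order.TTheory GRing.Theory Num.Theory.
Import numFieldNormedType.Exports.
Local Open Scope classical_set_scope.
Local Open Scope ring_scope.

(** * Squared norms and linear functionals on row vectors *)

Lemma continuous_sumr (R : realType) (T : topologicalType) (n : nat)
    (F : 'I_n -> T -> R) :
  (forall i, continuous (F i)) -> continuous (fun x => \sum_i F i x).
Proof.
move=> cF; apply: continuous_big => [|i _]; last exact: cF.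
exact: (@add_continuous R).
Qed.

Section SquaredNorm.
Variables (R : realType) (N : nat).
Implicit Types u v : 'rV[R]_N.

Definition sqnorm v : R := \sum_i v 0 i ^+ 2.

Lemma sqnorm_ge0 v : 0 <= sqnorm v.
Proof. by apply: sumr_ge0 => i _; exact: sqr_ge0. Qed.

Lemma sqr_coord_le_sqnorm v i : v 0 i ^+ 2 <= sqnorm v.
Proof.
rewrite /sqnorm (bigD1 i)//= lerDl.
by apply: sumr_ge0 => j _; exact: sqr_ge0.
Qed.

Lemma sqnorm_le0 v : sqnorm v <= 0 -> v = 0.
Proof.
move=> v0; apply/rowP => i; rewrite mxE; apply/eqP; rewrite -sqrf_eq0 eq_le.
by rewrite sqr_ge0 andbT (le_trans (sqr_coord_le_sqnorm v i)).
Qed.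

Lemma sqnormZ a v : sqnorm (a *: v) = a ^+ 2 * sqnorm v.
Proof. by rewrite mulr_sumr; apply: eq_bigr => i _; rewrite mxE exprMn. Qed.

(** The parallelogram identity, in the form that makes balls strictly convex:
    the midpoint of two vectors of squared norm at most r has squared norm less
    than r by a definite amount. *)
Lemma sqnorm_half u v :
  sqnorm (2^-1 *: (u + v)) =
  2^-1 * (sqnorm u + sqnorm v) - sqnorm (2^-1 *: (u - v)).
Proof.
rewrite -big_split/= mulr_sumr -sumrB; apply: eq_bigr => i _; rewrite !mxE.
by field.
Qed.

Lemma sqnorm_continuous : continuous sqnorm.
Proof.
apply: continuous_sumr => i v.
have ci := @coord_continuous R 1 N 0 i v.
exact: (continuousM ci ci).
Qed.

Lemma sqnorm_bounded r : bounded_set [set v | sqnorm v <= r].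
Proof.
exists (1 + `|r|); split; first exact: num_real.
move=> M rM v /= vr; rewrite /Num.norm/= mx_normrE.
apply/bigmax_leP; split; first by rewrite (le_trans _ (ltW rM))// addr_ge0.
move=> [i j] _ /=; rewrite (ord1 i) (le_trans _ (ltW rM))//.
have := le_trans (sqr_coord_le_sqnorm v j) vr => vjr.
rewrite -(@ler_pXn2r _ 2)// ?nnegrE ?addr_ge0// real_normK ?num_real//.
have := ler_norm r; have := normr_ge0 r; nra.
Qed.

End SquaredNorm.

Lemma rV_functional_sum (R : pzRingType) (N : nat) (f : 'rV[R]_N -> R) :
  scalar f -> forall v, f v = \sum_i v 0 i * f (delta_mx 0 i).
Proof.
move=> flin v; pose L := GRing.isLinear.Build _ _ _ _ f flin.
pose F : {scalar _} := HB.pack f L.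
rewrite -[LHS]/(F v) {1}[v]row_sum_delta linear_sum.
by apply: eq_bigr => i _; rewrite linearZ.
Qed.

Lemma rV_functional_continuous (R : realType) (N : nat) (f : 'rV[R]_N -> R) :
  scalar f -> continuous f.
Proof.
move=> /rV_functional_sum fE; rewrite (funext fE).
apply: continuous_sumr => i v.
have ci := @coord_continuous R 1 N 0 i v.
have cc := @cst_continuous 'rV[R]_N R (f (delta_mx 0 i)) v.
exact: (continuousM ci cc).
Qed.

(** * Bounded groups of matrices *)

(** The radius of the orbit of v is the supremum over g of [sqnorm (T g v)]; it
    is constant along orbits.  The sublevel sets [K r] of the radius in C are
    compact, so the infimum of the radius is attained at some v.  If [T g v] were
    different from v, then the midpoint of the two would have a smaller radius:
    by [sqnorm_half] the squared norm of its image under [T h] is at most the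
    infimum minus [sqnorm (T h d)], where d is half the difference, and since the
    group is bounded this subtracted term is bounded below independently of
    h. *)
Lemma bounded_group_fixpoint (R : realType) (N : nat) (G : groupType)
    (T : G -> {linear 'rV[R]_N -> 'rV[R]_N}) (M : R) (C : set 'rV[R]_N) :
  (forall v, T 1%g v = v) ->
  (forall g h v, T (g * h)%g v = T h (T g v)) ->
  0 < M -> (forall g v, sqnorm (T g v) <= M * sqnorm v) ->
  C !=set0 -> closed C ->
  (forall u v, C u -> C v -> C (2^-1 *: (u + v))) ->
  (forall g v, C v -> C (T g v)) ->
  exists2 v, C v & forall g, T g v = v.
Proof.
move=> T1 TM M0 Tbnd [v0 Cv0] Ccl Cmid Cinv.
have qTcont g : continuous (fun v => sqnorm (T g v)).
  apply: continuous_sumr => i.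
  have cf : continuous (fun v => T g v 0 i).
    by apply: rV_functional_continuous => a u v; rewrite linearP !mxE.
  by move=> v; exact: (continuousM (cf v) (cf v)).
pose K r := [set v | C v /\ forall g, sqnorm (T g v) <= r].
have Kcl r : closed (K r).
  have -> : K r = C `&`
      \bigcap_g ((fun v => sqnorm (T g v)) @^-1` [set x | x <= r]).
    by apply/seteqP; split => v [Cv vr]; split=> // g; [move=> _|]; exact: vr.
  apply: closedI => //; apply: closed_bigI => g _.
  apply: preimage_closed; last exact: closed_le.
  by move=> v _; exact: qTcont.
have KC r : compact (K r).
  apply: bounded_closed_compact => //.
  have [B [Breal Bbnd]] := @sqnorm_bounded R N r.
  exists B; split=> // M' BM' v [_ /(_ 1%g)]; rewrite T1 => vr.
  exact: Bbnd BM' _ vr.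
pose E := [set r | K r !=set0].
have Einf : has_inf E.
  split; first by exists (M * sqnorm v0), v0; split.
  by exists 0 => r [v [_ /(_ 1%g)]]; apply: le_trans; exact: sqnorm_ge0.
have Kle r s : r <= s -> K r `<=` K s.
  by move=> rs v [Cv vr]; split=> // g; exact: le_trans (vr g) rs.
have Kgt r : inf E < r -> K r !=set0.
  move=> Er; have /(inf_adherent) /(_ Einf) [s [v Ksv]] : 0 < r - inf E.
    by rewrite subr_gt0.
  by rewrite addrC subrK => /ltW sr; exists v; exact: Kle sr _ Ksv.
have [v [Cv vE]] : K (inf E) !=set0.
  have /choice[w Kw] : forall m, exists w, K (inf E + m.+1%:R^-1) w.
    by move=> m; apply: Kgt; rewrite ltrDl invr_gt0.
  have [] := @KC (inf E + 1) (w @ \oo) _.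
    change (\forall m \near \oo, K (inf E + 1) (w m)).
    apply: nearW => m; apply: Kle (Kw m); rewrite lerD2l invf_le1//.
    by rewrite ler1n.
  move=> v [_ clv]; exists v.
  have Kv r : inf E < r -> K r v.
    move=> Er; apply: (Kcl r) => B /(clv (K r)); apply.
    change (\forall m \near \oo, K r (w m)).
    near=> m; apply: Kle (Kw m); rewrite -lerBrDl ltW//.
    by near: m; apply: near_infty_natSinv_lt (PosNum _); rewrite subr_gt0.
  split=> [|g]; first by have [] := Kv (inf E + 1) (ltr_pwDr ltr01 (lexx _)).
  apply/ler_addgt0Pr => e e0.
  by have [_] := Kv (inf E + e) (ltr_pwDr e0 (lexx _)); exact.
exists v => // g; apply/eqP; rewrite -subr_eq0.
pose d := 2^-1 *: (T g v - v).
(* Boundedness of the inverse of h bounds T h d from below. *)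
have dle h : sqnorm d <= M * sqnorm (T h d).
  by rewrite -{1}(T1 d) -(mulgV h) TM Tbnd.
suff : inf E <= inf E - M^-1 * sqnorm d.
  rewrite -subr_ge0 addrAC subrr add0r oppr_ge0 pmulr_rle0 ?invr_gt0//.
  by move/sqnorm_le0/eqP; rewrite scaler_eq0 invr_eq0 pnatr_eq0.
apply: (ge_inf Einf.2).
exists (2^-1 *: (T g v + v)); split; first by apply: Cmid => //; exact: Cinv.
move=> h; rewrite linearZ linearD sqnorm_half -linearB -linearZ -/d lerB//.
  by have := vE (g * h)%g; have := vE h; rewrite TM; lra.
by rewrite ler_pdivrMl//; exact: dle.
Unshelve. all: by end_near.
Qed.

Definition mxform (R : realType) (n : nat) (S : 'M[R]_n) (x y : 'rV[R]_n) : R :=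
  (x *m S *m y^T) 0 0.

Section MxForm.
Variables (R : realType) (n : nat).
Implicit Types (S A : 'M[R]_n) (x y z : 'rV[R]_n).

Lemma mxformPl S y : scalar (mxform S ^~ y).
Proof. by move=> a u v; rewrite /mxform !mulmxDl -!scalemxAl !mxE. Qed.

Lemma mxformNl S x y : mxform S (- x) y = - mxform S x y.
Proof. by rewrite /mxform !mulNmx mxE. Qed.

Lemma mxform_mulmx A S x y :
  mxform (A *m S *m A^T) x y = mxform S (x *m A) (y *m A).
Proof. by rewrite /mxform trmx_mul !mulmxA. Qed.

Lemma mxformE S x y : mxform S x y = \sum_i \sum_j S i j * (x 0 i * y 0 j).
Proof.
rewrite /mxform mxE exchange_big/=; apply: eq_bigr => j _.
by rewrite !mxE mulr_suml; apply: eq_bigr => i _; rewrite mulrCA mulrA.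
Qed.

Lemma mxform_sym S x y : S^T = S -> mxform S x y = mxform S y x.
Proof.
move=> Ssym; rewrite /mxform -[in LHS]Ssym -[x in LHS]trmxK -trmx_mul.
by rewrite -trmx_mul mulmxA mxE.
Qed.

Lemma mxform_scalar (a : R) x : mxform a%:M x x = a * sqnorm x.
Proof.
rewrite /mxform mul_mx_scalar -scalemxAl mxE; congr (_ * _); rewrite mxE.
by apply: eq_bigr => i _; rewrite mxE expr2.
Qed.

End MxForm.

Lemma sqr_sum_le (R : realType) (m : nat) (a : 'I_m -> R) (b : R) :
  (forall i, `|a i| <= b) -> (\sum_i a i) ^+ 2 <= (m%:R * b) ^+ 2.
Proof.
move=> ab; rewrite -[leLHS]real_normK ?num_real// ler_sqr ?nnegrE.
- apply: (le_trans (ler_norm_sum _ _ _)).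
  apply: (le_trans (ler_sum _ (fun i _ => ab i))).
  by rewrite sumr_const card_ord mulr_natl.
- exact: normr_ge0.
- case: m a ab => [|m] a ab; first by rewrite mul0r.
  by rewrite mulr_ge0// (le_trans (normr_ge0 _) (ab ord0)).
Qed.

Lemma sqnorm_mulmx_le (R : realType) (m p : nat) (A : 'M[R]_(m, p)) (B : R)
    (x : 'rV[R]_m) :
  0 <= B -> (forall i j, `|A i j| <= B) ->
  sqnorm (x *m A) <= p%:R * (m%:R * B) ^+ 2 * sqnorm x.
Proof.
move=> B0 AB.
have xk k : `|x 0 k| <= Num.sqrt (sqnorm x).
  by rewrite -sqrtr_sqr ler_wsqrtr// sqr_coord_le_sqnorm.
apply: (@le_trans _ _ (\sum_(j < p) (m%:R * (B * Num.sqrt (sqnorm x))) ^+ 2)).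
  apply: ler_sum => j _; rewrite mxE; apply: sqr_sum_le => k.
  by rewrite normrM mulrC ler_pM.
rewrite sumr_const card_ord mulrA exprMn sqr_sqrtr ?sqnorm_ge0//.
by rewrite -[leLHS]mulr_natl mulrA.
Qed.

Lemma sqnorm_mxvec (R : realType) (m n : nat) (W : 'M[R]_(m, n)) :
  sqnorm (mxvec W) = \sum_i sqnorm (row i W).
Proof.
rewrite /sqnorm pair_bigA/= (reindex _ (curry_mxvec_bij _ _))/=.
by apply: eq_bigr => -[i j] _; rewrite mxvecE !mxE.
Qed.

Lemma sqnorm_mxvec_trmx (R : realType) (m n : nat) (W : 'M[R]_(m, n)) :
  sqnorm (mxvec W^T) = sqnorm (mxvec W).
Proof.
rewrite !sqnorm_mxvec exchange_big/=; apply: eq_bigr => i _.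
by apply: eq_bigr => j _; rewrite !mxE.
Qed.

Lemma sqnorm_mxvec_mulmx_le (R : realType) (m p q : nat) (W : 'M[R]_(m, p))
    (A : 'M[R]_(p, q)) (c : R) :
  (forall x, sqnorm (x *m A) <= c * sqnorm x) ->
  sqnorm (mxvec (W *m A)) <= c * sqnorm (mxvec W).
Proof.
move=> Ac; rewrite !sqnorm_mxvec mulr_sumr; apply: ler_sum => i _.
by rewrite row_mul.
Qed.

(** The group acts on matrices by S |-> A(g) S A(g)^T.  The fixed point theorem
    is applied to the set C of the symmetric S that dominate
    [sqnorm (y *m A g)] for every g: this set is invariant because g ranges over
    a group, it contains a large multiple of the identity because the group is
    bounded, and all its elements are positive definite (take g = 1). *)
Lemma bounded_group_invariant_form (R : realType) (n : nat) (G : groupType)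
    (A : G -> 'M[R]_n) (B : R) :
  A 1%g = 1%:M -> (forall g h, A (g * h)%g = A h *m A g) ->
  (forall g i j, `|A g i j| <= B) ->
  exists S : 'M[R]_n, [/\ S^T = S, forall x, sqnorm x <= mxform S x x &
    forall g x y, mxform S (x *m A g) (y *m A g) = mxform S x y].
Proof.
move=> A1 AM AB.
pose B' := `|B| + 1.
have B'0 : 0 <= B' by rewrite addr_ge0.
have AB' g i j : `|A g i j| <= B'.
  by rewrite (le_trans (AB g i j))// (le_trans (ler_norm _))// lerDl.
(* c bounds the squared operator norms; it is kept above 1 so that c > 0 even
   if n = 0. *)
pose c := n%:R * (n%:R * B') ^+ 2 + 1.
have c1 : 1 <= c by rewrite lerDr mulr_ge0// sqr_ge0.
have c0 : 0 < c by exact: lt_le_trans c1.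
have bndW (W : 'M[R]_n) : (forall i j, `|W i j| <= B') ->
    forall x, sqnorm (x *m W) <= c * sqnorm x.
  move=> WB x; apply: (le_trans (sqnorm_mulmx_le x B'0 WB)).
  by rewrite ler_wpM2r ?sqnorm_ge0// lerDl.
pose T g : {linear 'rV[R]_(n * n) -> 'rV[R]_(n * n)} :=
  (mxvec \o (mulmxr (A g)^T \o (mulmx (A g) \o vec_mx))).
have TE g v : T g v = mxvec (A g *m vec_mx v *m (A g)^T) by [].
have vecT g v : vec_mx (T g v) = A g *m vec_mx v *m (A g)^T.
  by rewrite TE mxvecK.
pose C := [set v : 'rV[R]_(n * n) | (forall i j, vec_mx v j i - vec_mx v i j = 0)
  /\ forall g y, sqnorm (y *m A g) <= mxform (vec_mx v) y y].
have formP y : scalar (fun v : 'rV[R]_(n * n) => mxform (vec_mx v) y y).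
  by move=> a u v; rewrite /mxform linearP mulmxDr mulmxDl -scalemxAr
    -scalemxAl !mxE.
have [||||||||v [Csym Cv] Tv] := @bounded_group_fixpoint R _ G T (c * c) C.
- by move=> v; rewrite TE A1 trmx1 mulmx1 mul1mx vec_mxK.
- by move=> g h v; rewrite !TE mxvecK AM trmx_mul !mulmxA.
- by rewrite mulr_gt0.
- move=> g v; rewrite TE -mulrA.
  apply: (le_trans (sqnorm_mxvec_mulmx_le _ (c := c) _)).
    by apply: bndW => i j; rewrite mxE.
  rewrite ler_pM2l// -sqnorm_mxvec_trmx trmx_mul.
  apply: (le_trans (sqnorm_mxvec_mulmx_le _ (c := c) _)).
    by apply: bndW => i j; rewrite mxE.
  by rewrite sqnorm_mxvec_trmx vec_mxK.
- exists (mxvec c%:M); split=> [i j|g y]; rewrite mxvecK.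
    by rewrite !mxE eq_sym subrr.
  by rewrite mxform_scalar; exact: bndW.
- have -> : C = (\bigcap_i \bigcap_j (fun v => vec_mx v j i - vec_mx v i j)
      @^-1` [set x | x = 0]) `&`
    \bigcap_g \bigcap_y (fun v => mxform (vec_mx v) y y)
      @^-1` [set x | sqnorm (y *m A g) <= x].
    apply/seteqP; split=> v [sv fv]; split.
    + by move=> i _ j _; exact: sv.
    + by move=> g _ y _; exact: fv.
    + by move=> i j; exact: sv.
    + by move=> g y; exact: fv.
  apply: closedI; do 2 (apply: closed_bigI => ? _); apply: preimage_closed.
  + move=> v _; apply: rV_functional_continuous => a u w.
    by rewrite linearP !mxE; ring.
  + exact: closed_eq.
  + by move=> v _; exact: rV_functional_continuous.
  + exact: closed_ge.
- move=> u v [usym uf] [vsym vf]; split=> [i j|g y].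
    rewrite !linearE/= !mxE; have := usym i j; have := vsym i j; rewrite !mxE.
    lra.
  have -> : mxform (vec_mx (2^-1 *: (u + v))) y y =
      2^-1 * (mxform (vec_mx u) y y + mxform (vec_mx v) y y).
    rewrite /mxform linearZ linearD -scalemxAr -scalemxAl mulmxDr mulmxDl.
    by rewrite !mxE.
  have := uf g y; have := vf g y; lra.
- move=> g v [vsym vf]; have vs : (vec_mx v)^T = vec_mx v.
    by apply/matrixP => i j; rewrite mxE; apply/eqP; rewrite -subr_eq0 vsym.
  have Ts : (vec_mx (T g v))^T = vec_mx (T g v).
    by rewrite vecT !trmx_mul trmxK vs mulmxA.
  split=> [i j|h y]; first by rewrite -{1}Ts mxE subrr.
  rewrite vecT mxform_mulmx.
  have := vf (h * g^-1)%g (y *m A g).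
  by rewrite -mulmxA -AM mulgVK.
exists (vec_mx v); split.
- by apply/matrixP => i j; rewrite mxE; apply/eqP; rewrite -subr_eq0 Csym.
- by move=> x; have := Cv 1%g x; rewrite A1 mulmx1.
- by move=> g x y; rewrite -mxform_mulmx -vecT Tv.
Qed.

(** * The adjoint representation in charts *)

Section DifferentiablePairs.
Variables (R : realType) (U V W : normedModType R).

Lemma is_diff_paircl (u : U) (y : V) :
  is_diff y (fun z => (u, z)) (fun z => (0, z)).
Proof. exact: (@is_diff_pair _ _ _ _ (cst u) (cst 0) id id y). Qed.

Lemma is_diff_paircr (v : V) (x : U) :
  is_diff x (fun z => (z, v)) (fun z => (z, 0)).
Proof. exact: (@is_diff_pair _ _ _ _ id id (cst v) (cst 0) x). Qed.

End DifferentiablePairs.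

Section Charts.
Variables (R : realType) (n : nat) (G : lieGroupType R n).
Implicit Types (b c d e : chart R n G) (g h : G).

Lemma chart_cod_map c g : chart_dom c g -> chart_cod c (chart_map c g).
Proof. by move=> cg; exists g. Qed.

Lemma chart_inv_cvg c g : chart_dom c g ->
  chart_inv c x @[x --> chart_map c g] --> g.
Proof.
move=> cg; rewrite -[X in _ --> X](chart_mapK cg).
exact: chart_inv_continuous (chart_cod_map cg).
Qed.

Lemma chart_map_cvg c g : chart_dom c g ->
  chart_map c h @[h --> g] --> chart_map c g.
Proof. exact: chart_map_continuous. Qed.

Lemma near_chart_dom c g : chart_dom c g -> \forall h \near g, chart_dom c h.
Proof.
by move=> cg; apply: open_nbhs_nbhs; split=> //; exact: chart_dom_open.
Qed.

Lemma near_chart_cod c g : chart_dom c g ->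
  \forall x \near chart_map c g, chart_cod c x.
Proof.
move=> cg; apply: open_nbhs_nbhs; split; first exact: chart_cod_open.
exact: chart_cod_map.
Qed.

Lemma chart_invK c x : chart_cod c x -> chart_map c (chart_inv c x) = x.
Proof. by move=> [g cg <-]; rewrite chart_mapK. Qed.

Lemma mulg_cvg (T : Type) (F : set_system T) {FF : Filter F} (f f' : T -> G)
    g h : f @ F --> g -> f' @ F --> h -> (f x * f' x)%g @[x --> F] --> (g * h)%g.
Proof.
move=> fg fh.
apply: (@cvg_comp _ _ _ (fun x => (f x, f' x)) (fun p : G * G => (p.1 * p.2)%g)
  F (nbhs (g, h))).
  exact: cvg_pair.
exact: (mulg_continuous (g, h)).
Qed.

Definition chart_mul b c d (p : 'rV[R]_n * 'rV[R]_n) : 'rV[R]_n :=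
  chart_map d (chart_inv b p.1 * chart_inv c p.2)%g.

Definition chart_conj c g (y : 'rV[R]_n) : 'rV[R]_n :=
  chart_map c (g * chart_inv c y * g^-1)%g.

Lemma AdE c g Y : Ad c g Y = 'D_Y (chart_conj c g) (chart_map c 1%g).
Proof. by []. Qed.

Section ChartMul.
Variables (b c d : chart R n G) (g h : G).
Hypotheses (ab : atlas b) (ac : atlas c) (ad : atlas d).
Hypotheses (bg : chart_dom b g) (ch : chart_dom c h)
  (dgh : chart_dom d (g * h)%g).

Let U := [set p : 'rV[R]_n * 'rV[R]_n | [/\ chart_cod b p.1, chart_cod c p.2
   & chart_dom d (chart_inv b p.1 * chart_inv c p.2)%g]].

Let Ugh : U (chart_map b g, chart_map c h).
Proof. by split; rewrite /= ?chart_mapK//; exact: chart_cod_map. Qed.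

Lemma chart_mulE : chart_mul b c d (chart_map b g, chart_map c h) =
  chart_map d (g * h)%g.
Proof. by rewrite /chart_mul/= !chart_mapK. Qed.

Lemma chart_mul_differentiable :
  differentiable (chart_mul b c d) (chart_map b g, chart_map c h).
Proof. exact: (mulg_smooth _ _ _ ab ac ad 1%N).1. Qed.

Lemma chart_mul_diff_continuous v :
  {for (chart_map b g, chart_map c h),
    continuous (fun p => 'd (chart_mul b c d) p v)}.
Proof. exact: (mulg_smooth _ _ _ ab ac ad 1%N).2. Qed.

Lemma chart_mul_diff_differentiable v :
  differentiable (fun p => 'd (chart_mul b c d) p v)
    (chart_map b g, chart_map c h).
Proof. exact: ((mulg_smooth _ _ _ ab ac ad 2%N).2 v).1. Qed.

End ChartMul.

Section Conjugation.
Variables (b c e : chart R n G) (g : G).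
Hypotheses (ab : atlas b) (ac : atlas c) (ae : atlas e).
Hypotheses (bg : chart_dom b g) (c1 : chart_dom c 1%g) (eg : chart_dom e g^-1%g).

(** Conjugation by g is left multiplication by g followed by right
    multiplication by g^-1.  The intermediate values lie near g, so they are read
    in a chart b around g, and g^-1 is read in a chart e around it; smoothness of
    the multiplication then applies to both factors. *)
Definition conj_decomp : 'rV[R]_n -> 'rV[R]_n :=
  (chart_mul b e c \o (fun z => (z, chart_map e g^-1%g))) \o
  (chart_mul b c b \o (fun y => (chart_map b g, y))).

Lemma near_chart_conj :
  \forall y \near chart_map c 1%g, chart_conj c g y = conj_decomp y.
Proof.
have gy : (g * chart_inv c y)%g @[y --> chart_map c 1%g] --> g.
  by rewrite -[X in _ --> X]mulg1;
    exact: (mulg_cvg (cvg_cst g) (chart_inv_cvg c1)).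
near=> y; have bgy : chart_dom b (g * chart_inv c y)%g.
  by near: y; apply: gy; exact: near_chart_dom.
by rewrite /conj_decomp/chart_mul/= !chart_mapK.
Unshelve. all: by end_near. Qed.

Lemma is_diff_conj_decomp :
  is_diff (chart_map c 1%g) conj_decomp
    (fun Y => 'd (chart_mul b e c) (chart_map b g, chart_map e g^-1%g)
      ('d (chart_mul b c b) (chart_map b g, chart_map c 1%g) (0, Y), 0)).
Proof.
have bg1 : chart_dom b (g * 1)%g by rewrite mulg1.
have cgV : chart_dom c (g * g^-1)%g by rewrite mulgV.
have E1 := chart_mulE b bg c1; rewrite mulg1 in E1.
have D1 := chart_mul_differentiable ab ac ab bg c1 bg1.
have D2 := chart_mul_differentiable ab ae ac bg eg cgV.
have I1 := is_diff_comp (is_diff_paircl _ _) (differentiableP D1).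
have I2 z : z = chart_map b g -> is_diff z
    (chart_mul b e c \o (fun z => (z, chart_map e g^-1%g)))
    ('d (chart_mul b e c) (chart_map b g, chart_map e g^-1%g) \o
       (fun Z => (Z, 0))).
  by move=> ->; exact: is_diff_comp (is_diff_paircr _ _) (differentiableP D2).
exact: is_diff_comp I1 (I2 _ E1).
Qed.

Lemma AdE_decomp Y : Ad c g Y =
  'd (chart_mul b e c) (chart_map b g, chart_map e g^-1%g)
      ('d (chart_mul b c b) (chart_map b g, chart_map c 1%g) (0, Y), 0).
Proof.
rewrite AdE (near_eq_derive _ near_chart_conj).
have D := is_diff_conj_decomp.
by rewrite deriveE ?diff_val//; exact: ex_diff.
Qed.

End Conjugation.

End Charts.

Section Adjoint.
Variables (R : realType) (n : nat) (G : lieGroupType R n) (c : chart R n G).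
Hypotheses (ac : atlas c) (c1 : chart_dom c 1%g).
Implicit Types g h : G.

(** A differentiable representative of the germ of the conjugation at 1; the
    chain rule for Ad is applied to it. *)
Lemma chart_conj_diff g : exists phi : 'rV[R]_n -> 'rV[R]_n,
  (\forall y \near chart_map c 1%g, chart_conj c g y = phi y) /\
  is_diff (chart_map c 1%g) phi (Ad c g).
Proof.
have [b ab bg] := atlas_cover g; have [e ae eg] := atlas_cover g^-1%g.
exists (conj_decomp b c e g); split; first exact: near_chart_conj.
have -> : Ad c g = (fun Y => 'd (chart_mul b e c)
    (chart_map b g, chart_map e g^-1%g)
    ('d (chart_mul b c b) (chart_map b g, chart_map c 1%g) (0, Y), 0)).
  by apply/funext => Y; exact: AdE_decomp.
exact: (is_diff_conj_decomp ab ac ae bg c1 eg).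
Qed.

Lemma chart_conj1 g : chart_conj c g (chart_map c 1%g) = chart_map c 1%g.
Proof. by rewrite /chart_conj chart_mapK// mulg1 mulgV. Qed.

Definition Ad_mx g : 'M[R]_n := lin1_mx (Ad c g).

Lemma Ad_mxE g Y : Ad c g Y = Y *m Ad_mx g.
Proof.
rewrite /Ad_mx; have [phi [_ [_ <-]]] := chart_conj_diff g.
by rewrite mul_rV_lin1.
Qed.

Lemma AdM g h Y : Ad c (g * h)%g Y = Ad c g (Ad c h Y).
Proof.
have [phi [gphi Dphi]] := chart_conj_diff g.
have [psi [hpsi Dpsi]] := chart_conj_diff h.
have psi1 : psi (chart_map c 1%g) = chart_map c 1%g.
  by rewrite -(nbhs_singleton hpsi) chart_conj1.
have D z : z = chart_map c 1%g -> is_diff z phi (Ad c g) by move=> ->.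
have Dc := is_diff_comp Dpsi (D _ psi1).
have cont : psi y @[y --> chart_map c 1%g] --> chart_map c 1%g.
  rewrite -[X in _ --> X]psi1.
  by apply: differentiable_continuous; case: Dpsi.
rewrite AdE (near_eq_derive (g := phi \o psi)).
  by rewrite deriveE ?diff_val//; exact: ex_diff.
near=> y.
have -> : (phi \o psi) y = chart_conj c g (psi y).
  apply/esym; near: y.
  exact: (cont [set z | chart_conj c g z = phi z]).
rewrite -(near hpsi y)//.
have cy : chart_dom c (h * chart_inv c y * h^-1)%g.
  near: y.
  have hy : (h * chart_inv c y * h^-1)%g @[y --> chart_map c 1%g] --> (1 : G)%g.
    rewrite -[X in _ --> X](mulgV h) -[X in _ --> (X * _)%g]mulg1.
    exact: (mulg_cvg (mulg_cvg (cvg_cst h) (chart_inv_cvg c1)) (cvg_cst h^-1%g)).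
  by apply: hy; exact: near_chart_dom.
by rewrite /chart_conj chart_mapK// invgM !mulgA.
Unshelve. all: by end_near. Qed.

Lemma Ad1 Y : Ad c 1%g Y = Y.
Proof.
rewrite AdE (near_eq_derive (g := id)); first by rewrite derive_id.
near=> y; rewrite /chart_conj mul1g invg1 mulg1 chart_invK//.
by near: y; exact: near_chart_cod.
Unshelve. all: by end_near. Qed.

Lemma Ad_mx1 : Ad_mx 1%g = 1%:M.
Proof.
by apply/row_matrixP => i; rewrite !rowE -(Ad_mxE 1%g) Ad1 mulmx1.
Qed.

Lemma Ad_mxM g h : Ad_mx (g * h)%g = Ad_mx h *m Ad_mx g.
Proof.
apply/row_matrixP => i; rewrite rowE -(Ad_mxE (g * h)%g) AdM.
by rewrite (Ad_mxE h) (Ad_mxE g) -mulmxA -rowE.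
Qed.

(** The product of the Jacobian matrices of the two factors of [conj_decomp].
    Both are partial Jacobians of the multiplication at points that depend on g
    through charts, which gives the regularity of Ad in g. *)
Lemma Ad_mx_decomp b e g i j : atlas b -> atlas e ->
  chart_dom b g -> chart_dom e g^-1%g ->
  Ad_mx g i j = \sum_k
    'd (chart_mul b c b) (chart_map b g, chart_map c 1%g) (0, delta_mx 0 i) 0 k *
    'd (chart_mul b e c) (chart_map b g, chart_map e g^-1%g)
      (delta_mx 0 k, 0) 0 j.
Proof.
move=> ab ae bg eg; rewrite mxE (AdE_decomp ab ac ae bg c1 eg).
set L := 'd _ (_, chart_map e _).
apply: (rV_functional_sum (f := fun Z => L (Z, 0) 0 j)) => a u v.
have -> : (a *: u + v, 0) = a *: (u, 0) + (v, 0) :> 'rV[R]_n * 'rV[R]_n.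
  transitivity (a *: u + v, a *: (0 : 'rV[R]_n) + 0) => //.
  by rewrite scaler0 addr0.
by rewrite linearP !mxE.
Qed.

End Adjoint.

Section AdjointRegularity.
Variables (R : realType) (n : nat) (G : lieGroupType R n) (c : chart R n G).
Hypotheses (ac : atlas c) (c1 : chart_dom c 1%g).
Implicit Types g h : G.

Lemma Ad_mx_continuous i j : continuous (fun g => Ad_mx c g i j).
Proof.
move=> g; have [b ab bg] := atlas_cover g.
have [e ae eg] := atlas_cover g^-1%g.
have gV : h^-1%g @[h --> g] --> g^-1%g by exact: invg_continuous.
pose F h := \sum_k
  'd (chart_mul b c b) (chart_map b h, chart_map c 1%g) (0, delta_mx 0 i) 0 k *
  'd (chart_mul b e c) (chart_map b h, chart_map e h^-1%g) (delta_mx 0 k, 0) 0 j.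
have FE : \forall h \near g, F h = Ad_mx c h i j.
  near=> h; rewrite (Ad_mx_decomp ac c1 i j ab ae)//; near: h.
    exact: near_chart_dom.
  exact: (gV (chart_dom e) (near_chart_dom eg)).
rewrite /continuous_at -(nbhs_singleton FE).
apply: (cvg_trans (near_eq_cvg FE)).
have cb : chart_map b h @[h --> g] --> chart_map b g by exact: chart_map_cvg.
have ce : chart_map e h^-1%g @[h --> g] --> chart_map e g^-1%g.
  exact: (cvg_comp _ _ gV (chart_map_cvg eg)).
apply: cvg_big => [|k _]; first exact: (@add_continuous R).
have bg1 : chart_dom b (g * 1)%g by rewrite mulg1.
have cgV : chart_dom c (g * g^-1)%g by rewrite mulgV.
have D1 := chart_mul_diff_continuous ab ac ab bg c1 bg1 (v := (0, delta_mx 0 i)).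
have D2 := chart_mul_diff_continuous ab ae ac bg eg cgV (v := (delta_mx 0 k, 0)).
have P1 : (chart_map b h, chart_map c 1%g) @[h --> g] -->
    (chart_map b g, chart_map c 1%g) by exact: cvg_pair cb (cvg_cst _).
have P2 : (chart_map b h, chart_map e h^-1%g) @[h --> g] -->
    (chart_map b g, chart_map e g^-1%g) by exact: cvg_pair cb ce.
have C1 := cvg_comp _ _ (cvg_comp _ _ P1 D1) (@coord_continuous R 1 n 0 k _).
have C2 := cvg_comp _ _ (cvg_comp _ _ P2 D2) (@coord_continuous R 1 n 0 j _).
exact: (cvgM C1 C2).
Unshelve. all: by end_near. Qed.

Lemma Ad_mx_bounded : compact [set: G] ->
  exists B : R, forall g i j, `|Ad_mx c g i j| <= B.
Proof.
move=> cG.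
have /choice[f fP] : forall ij : 'I_n * 'I_n,
    exists B : R, forall g, `|Ad_mx c g ij.1 ij.2| <= B.
  move=> [i j]; have /compact_bounded[B [Br BP]] :
      compact ((fun g => Ad_mx c g i j) @` [set: G]).
    apply: continuous_compact cG; apply: continuous_subspaceT.
    exact: Ad_mx_continuous.
  exists (B + 1) => g; apply: (BP (B + 1)); first by rewrite ltrDl.
  by exists g.
exists (\sum_ij `|f ij|) => g i j.
rewrite (le_trans (fP (i, j) g))// (le_trans (ler_norm _))//.
by rewrite (bigD1 (i, j))//= lerDl sumr_ge0.
Qed.

Definition chart_invg (x : 'rV[R]_n) : 'rV[R]_n :=
  chart_map c (chart_inv c x)^-1%g.

(** By [Ad_mx_decomp] with b = e = c, the entries of Ad(g) are sums of products
    of first derivatives of the multiplication, evaluated at points depending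
    smoothly on g; as the multiplication is twice differentiable, they are
    differentiable.  The matrix function M agrees with Ad only near 1, where the
    inverse still lies in the domain of c. *)
Lemma Ad_mx_chart_differentiable : exists M : 'rV[R]_n -> 'M[R]_n,
  (\forall x \near chart_map c 1%g, Ad_mx c (chart_inv c x) = M x) /\
  forall i j, differentiable (fun x => M x i j) (chart_map c 1%g).
Proof.
pose a i k x := 'd (chart_mul c c c) (x, chart_map c 1%g) (0, delta_mx 0 i) 0 k.
pose b k j x := 'd (chart_mul c c c) (x, chart_invg x) (delta_mx 0 k, 0) 0 j.
have cinv : chart_dom c (chart_inv c (chart_map c 1%g))^-1%g.
  by rewrite chart_mapK// invg1.
have c11 : chart_dom c (1 * 1 : G)%g by rewrite mulg1.
have inv1 : chart_invg (chart_map c 1%g) = chart_map c 1%g.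
  by rewrite /chart_invg chart_mapK// invg1.
have da i k : differentiable (a i k) (chart_map c 1%g).
  apply: (differentiable_comp _ (differentiable_coord _ 0 k)).
  apply: (differentiable_comp (f := fun x => (x, chart_map c 1%g))
     (g := fun p => 'd (chart_mul c c c) p (0, delta_mx 0 i))).
    by case: (is_diff_paircr (chart_map c 1%g) (chart_map c 1%g)).
  exact: (chart_mul_diff_differentiable ac ac ac c1 c1 c11).
have db k j : differentiable (b k j) (chart_map c 1%g).
  apply: (differentiable_comp _ (differentiable_coord _ 0 j)).
  apply: (differentiable_comp (f := fun x => (x, chart_invg x))
     (g := fun p => 'd (chart_mul c c c) p (delta_mx 0 k, 0))).
    apply: differentiable_pair; first by case: (is_diff_id (chart_map c 1%g)).
    apply: (invg_smooth c c ac ac 1%N).1.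
    by split=> //; exact: chart_cod_map.
  rewrite inv1.
  exact: (chart_mul_diff_differentiable ac ac ac c1 c1 c11).
exists (fun x => \matrix_(i, j) (\sum_k a i k * b k j) x); split.
  near=> x; apply/matrixP => i j; rewrite [RHS]mxE.
  have cx : chart_cod c x by near: x; exact: near_chart_cod.
  have domx : chart_dom c (chart_inv c x).
    by have [g cg <-] := cx; rewrite chart_mapK.
  have domV : chart_dom c (chart_inv c x)^-1%g.
    near: x.
    have ciV : (chart_inv c x)^-1%g @[x --> chart_map c 1%g] --> (1 : G)%g.
      rewrite -[X in _ --> X]invg1.
      exact: (cvg_comp _ _ (chart_inv_cvg c1) (invg_continuous 1%g)).
    exact: (ciV (chart_dom c) (near_chart_dom c1)).
  rewrite (Ad_mx_decomp ac c1 i j ac ac domx domV) chart_invK// fct_sumE.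
  by apply: eq_bigr.
move=> i j; rewrite (_ : (fun x => _) = \sum_k a i k * b k j); last first.
  by apply/funext => x; rewrite mxE.
by apply: differentiable_sum => k; exact: differentiableM.
Unshelve. all: by end_near. Qed.

End AdjointRegularity.

(** * Invariant forms and the bracket *)

Section DeriveForm.
Variables (R : realType) (n : nat) (V : normedModType R).
Implicit Types (f : V -> 'rV[R]_n) (S : 'M[R]_n) (a v : V).

Lemma derive_rV f a v j :
  (forall k, differentiable (fun x => f x 0 k) a) ->
  'D_v f a 0 j = 'D_v (fun x => f x 0 j) a.
Proof.
move=> df; pose F k x := f x 0 k *: (delta_mx 0 k : 'rV[R]_n).
have dF k : differentiable (F k) a by exact: differentiableZl.
have -> : f = \sum_k F k.
  by apply/funext => x; rewrite fct_sumE; exact: row_sum_delta.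
rewrite derive_sum => [|k]; last exact: diff_derivable.
rewrite summxE (bigD1 j)//= big1 => [|k kj].
  rewrite addr0 deriveE// diffZl//= !mxE !eqxx mulr1 -deriveE//.
  congr ('D_v _ a); apply/funext => x.
  by rewrite fct_sumE -row_sum_delta.
by rewrite deriveE// diffZl//= !mxE eq_sym (negbTE kj) andbF mulr0.
Qed.

(** Product rule for a form that is constant along two curves. *)
Lemma derive_mxform S f f' a v (r : R) :
  (forall k, differentiable (fun x => f x 0 k) a) ->
  (forall k, differentiable (fun x => f' x 0 k) a) ->
  (\forall x \near a, mxform S (f x) (f' x) = r) ->
  mxform S ('D_v f a) (f' a) + mxform S (f a) ('D_v f' a) = 0.
Proof.
move=> df df' fr.
have /(near_eq_derive v) : \forall x \near a, 
    mxform S (f x) (f' x) = cst r x by [].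
rewrite derive_cst => <-.
pose p i j := (fun x => f x 0 i) * (fun x => f' x 0 j).
have dp i j : derivable (p i j) a v.
  by apply: derivableM; exact: diff_derivable.
have -> : (fun x => mxform S (f x) (f' x)) = \sum_i \sum_j S i j *: p i j.
  apply/funext => x; rewrite mxformE fct_sumE; apply: eq_bigr => i _.
  by rewrite fct_sumE.
have dS i j : derivable (S i j *: p i j) a v by exact: derivableZ.
rewrite derive_sum => [|i]; last exact: derivable_sum.
rewrite !mxformE -big_split; apply: eq_bigr => i _ /=.
rewrite derive_sum// -big_split; apply: eq_bigr => j _ /=.
rewrite deriveZ// deriveM; [|exact: diff_derivable..].
by rewrite !derive_rV// /GRing.scale/=; ring.
Qed.

End DeriveForm.

(** The bracket of X and Y is the derivative of Ad(g) Y at g = 1 in the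
    direction X, so this is the derivative at 1 of the Ad-invariance of S. *)
Lemma lie_group_bracket_skew (R : realType) (n : nat) (G : lieGroupType R n)
    (c : chart R n G) (S : 'M[R]_n) : atlas c -> chart_dom c 1%g ->
  (forall g x y, mxform S (x *m Ad_mx c g) (y *m Ad_mx c g) = mxform S x y) ->
  forall X Y Z, mxform S (lie_group_bracket c X Y) Z +
    mxform S Y (lie_group_bracket c X Z) = 0.
Proof.
move=> ac c1 Sinv X Y Z.
have [M [AM dM]] := Ad_mx_chart_differentiable ac c1.
have M1 : M (chart_map c 1%g) = 1%:M.
  by rewrite -(nbhs_singleton AM) chart_mapK// Ad_mx1.
have brE Y' : lie_group_bracket c X Y' =
    'D_X (fun x => Y' *m M x) (chart_map c 1%g).
  apply: near_eq_derive; near=> x.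
  by rewrite Ad_mxE// (near AM x).
have dYM (Y' : 'rV[R]_n) k :
    differentiable (fun x => (Y' *m M x) 0 k) (chart_map c 1%g).
  have -> : (fun x => (Y' *m M x) 0 k) = \sum_i (fun x => Y' 0 i *: M x i k).
    by apply/funext => x; rewrite fct_sumE mxE.
  by apply: differentiable_sum => i; exact: differentiableZ.
have := @derive_mxform R n _ S (fun x => Y *m M x) (fun x => Z *m M x)
  (chart_map c 1%g) X (mxform S Y Z) (dYM Y) (dYM Z).
rewrite -!brE M1 !mulmx1; apply.
near=> x; rewrite -(near AM x)//; exact: Sinv.
Unshelve. all: by end_near. Qed.

(** * Invariant scalar products on a compact simple Lie algebra *)

Section LieBasics.
Variables (R : comNzRingType) (L : lieAlgType R).
Implicit Types x y : L.

Lemma lieDl x y z : lie (x + y) z = lie x z + lie y z :> L.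
Proof. by have := lie_linearl z 1 x y; rewrite !scale1r. Qed.

Lemma lieDr x y z : lie z (x + y) = lie z x + lie z y :> L.
Proof. by have := lie_linearr z 1 x y; rewrite !scale1r. Qed.

Lemma lie0l y : lie 0 y = 0 :> L.
Proof. by apply: (addrI (lie 0 y)); rewrite -lieDl !addr0. Qed.

Lemma lieC x y : lie x y = - lie y x :> L.
Proof.
apply/eqP; rewrite -addr_eq0; apply/eqP.
by have := liexx (x + y); rewrite lieDl !lieDr !liexx add0r addr0.
Qed.

End LieBasics.

Section FormsOnSubspaces.
Variables (R : realType) (L : lieAlgType R).
Implicit Types (K : set L) (kappa : L -> L -> R).

(** The forms are total functions on L, so that subspaces need no types of their
    own; their values outside K are irrelevant. *)
Definition invariant_scalar_product_on K kappa : Prop :=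
  [/\ forall a x y z, K x -> K y -> K z ->
        kappa (a *: x + y) z = a * kappa x z + kappa y z,
      forall x y, K x -> K y -> kappa x y = kappa y x,
      forall x, K x -> x != 0 -> 0 < kappa x x &
      forall x y z, K x -> K y -> K z -> kappa (lie x y) z = kappa x (lie y z)].

Lemma invariant_scalar_product_restrict K kappa :
  invariant_scalar_product kappa -> invariant_scalar_product_on K kappa.
Proof.
move=> [[_ linl] sym pos inv]; split=> [a x y z _ _ _|x y _ _|x _|x y z _ _ _].
- exact: linl.
- exact: sym.
- exact: pos.
- exact: inv.
Qed.

Lemma invariant_scalar_product_on_sub K K' kappa : K `<=` K' ->
  invariant_scalar_product_on K' kappa -> invariant_scalar_product_on K kappa.
Proof.
move=> KK' [lin sym pos inv].
split=> [a x y z Kx Ky Kz|x y Kx Ky|x Kx|x y z Kx Ky Kz].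
- by apply: lin; exact: KK'.
- by apply: sym; exact: KK'.
- by apply: pos; exact: KK'.
- by apply: inv; exact: KK'.
Qed.

Lemma invariant_scalar_product_onZ K kappa c : 0 < c ->
  invariant_scalar_product_on K kappa ->
  invariant_scalar_product_on K (fun x y => c * kappa x y).
Proof.
move=> c0 [lin sym pos inv].
split=> [a x y z Kx Ky Kz|x y Kx Ky|x Kx xn0|x y z Kx Ky Kz].
- by rewrite lin//; ring.
- by rewrite sym.
- by rewrite mulr_gt0// pos.
- by rewrite inv.
Qed.

Lemma compact_lie_invariant_scalar_product K n (G : lieGroupType R n) :
  compact [set: G] -> is_lie_algebra_of K G ->
  exists kappa, invariant_scalar_product_on K kappa.
Proof.
move=> cG [c [ac c1 [f [finj fK fbr]]]].
have [B AdB] := Ad_mx_bounded ac c1 cG.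
have [S [Ssym Spos Sinv]] := bounded_group_invariant_form (Ad_mx1 ac c1)
  (Ad_mxM ac c1) AdB.
have skew := lie_group_bracket_skew ac c1 Sinv.
have /choice[k kP] : forall x : L, exists v, K x -> f v = x.
  move=> x; have [Kx|nKx] := pselect (K x); last by exists 0.
  by move: Kx; rewrite -fK => -[v _ <-]; exists v.
have fk v : k (f v) = v by apply: finj; apply: kP; rewrite -fK; exists v.
exists (fun x y => mxform S (k x) (k y)).
have onK x : K x -> exists v, x = f v by rewrite -fK => -[v _ <-]; exists v.
split=> [a x y z /onK[u ->] /onK[v ->] /onK[w ->]|x y _ _|x /onK[u ->] fu0|
  x y z /onK[u ->] /onK[v ->] /onK[w ->]].
- by rewrite -linearP !fk mxformPl.
- exact: mxform_sym.
- rewrite fk; apply: lt_le_trans (Spos u).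
  rewrite lt_neqAle sqnorm_ge0 andbT eq_sym.
  by apply: contra fu0 => /eqP u0; rewrite (@sqnorm_le0 _ _ u) ?linear0// u0.
- rewrite (lieC (f u)) -!fbr -linearN !fk mxformNl.
  by have /eqP := skew v u w; rewrite addr_eq0 => /eqP ->; rewrite opprK.
Qed.

(** If delta(x0, x0) = 0, then delta(y + t x0, y + t x0) is affine in t and
    nonnegative, so delta(x0, y) = 0.  Hence x0 lies in the radical of delta.  By
    invariance the radical is an ideal, and simplicity makes it all of K. *)
Lemma psd_invariant_form_radical K (delta : L -> L -> R) x0 :
  lie_subalgebra K -> simple_lie K ->
  (forall a x y z, K x -> K y -> K z ->
        delta (a *: x + y) z = a * delta x z + delta y z) ->
  (forall x y, K x -> K y -> delta x y = delta y x) ->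
  (forall x, K x -> 0 <= delta x x) ->
  (forall x y z, K x -> K y -> K z -> delta (lie x y) z = delta x (lie y z)) ->
  K x0 -> x0 != 0 -> delta x0 x0 = 0 ->
  forall x y, K x -> K y -> delta x y = 0.
Proof.
move=> [[K0 Klin] Klie] [_ Ksimple] lin sym psd inv Kx0 x0n0 d0.
pose I := [set x | K x /\ forall y, K y -> delta x y = 0].
have Ix0 : I x0.
  split=> // y Ky; apply/eqP/negPn/negP => dn0.
  (* This t makes the affine function of t equal to -1. *)
  pose t := - (delta y y + 1) / (2 * delta x0 y).
  have Kty : K (t *: x0 + y) by exact: Klin.
  have := psd _ Kty; rewrite lin// (sym x0 _ Kx0 Kty) (sym y _ Ky Kty) !lin//.
  rewrite d0 (sym y x0)//.
  have -> : t * (t * 0 + delta x0 y) + (t * delta x0 y + delta y y) = -1.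
    by rewrite /t; field.
  lra.
have II : lie_ideal_of K I.
  have d0l z : K z -> delta 0 z = 0.
    by move=> Kz; have := lin 1 0 0 z K0 K0 Kz; rewrite scale1r addr0; lra.
  split=> [|x [] //|x y Kx [Ky dy]].
    split=> [|a x y [Kx dx] [Ky dy]]; first by split.
    by split=> [|z Kz]; [exact: Klin|rewrite lin// dx// dy// mulr0 addr0].
  split=> [|z Kz]; first exact: Klie.
  have Kyx := Klie _ _ Ky Kx; have Kxz := Klie _ _ Kx Kz.
  rewrite lieC -[X in delta X]addr0 -scaleN1r lin// d0l// inv// dy//.
  by rewrite mulr0 addr0.
have IK : I = K.
  have [I0|//] := Ksimple I II; move: Ix0; rewrite I0 => x00.
  by move: x0n0; rewrite x00 eqxx.
by move=> x y; rewrite -{1}IK => -[_ dx] /dx.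
Qed.

Lemma mxform_continuous n (S : 'M[R]_n) : continuous (fun v => mxform S v v).
Proof.
under eq_fun do rewrite mxformE.
apply: continuous_sumr => i; apply: continuous_sumr => j v.
have ci := @coord_continuous R 1 n 0 i v.
have cj := @coord_continuous R 1 n 0 j v.
have cc := @cst_continuous 'rV[R]_n R (S i j) v.
exact: (continuousM cc (continuousM ci cj)).
Qed.

(** The ratio of the two forms is homogeneous of degree 0, so its minimum over
    the compact unit sphere is its minimum over all nonzero vectors. *)
Lemma mxform_ratio_min n (S S' : 'M[R]_n) : (0 < n)%N ->
  (forall v, v != 0 -> 0 < mxform S v v) ->
  (forall v, v != 0 -> 0 < mxform S' v v) ->
  exists c u, [/\ 0 < c, u != 0, mxform S' u u = c * mxform S u u &
    forall v, c * mxform S v v <= mxform S' v v].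
Proof.
move=> n0 Spos S'pos.
have Z (T : 'M[R]_n) a v : mxform T (a *: v) (a *: v) = a ^+ 2 * mxform T v v.
  by rewrite /mxform linearZ/= -scalemxAr -!scalemxAl scalerA mxE expr2.
pose sphere := [set v : 'rV[R]_n | sqnorm v = 1].
have neq0 v : sphere v -> v != 0.
  move=> v1; apply/eqP => v0; move: v1; rewrite /sphere/= v0 => /eqP.
  by rewrite -(scale0r (0 : 'rV[R]_n)) sqnormZ expr0n mul0r eq_sym oner_eq0.
have compact_sphere : compact sphere.
  apply: bounded_closed_compact.
    have [B [Br BP]] := @sqnorm_bounded R n 1.
    by exists B; split=> // M BM v v1; apply: (BP M) => //=; rewrite v1.
  rewrite (_ : sphere = @sqnorm R n @^-1` [set x | x = 1])//.
  apply: preimage_closed; last exact: closed_eq.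
  by move=> v _; exact: sqnorm_continuous.
have normalize v : v != 0 -> sphere ((Num.sqrt (sqnorm v))^-1 *: v).
  move=> vn0; rewrite /sphere/= sqnormZ exprVn sqr_sqrtr ?sqnorm_ge0// mulVf//.
  by apply: contra vn0 => /eqP sv; rewrite (@sqnorm_le0 _ _ v)// sv.
have sphere0 : sphere !=set0.
  have dn0 : (const_mx 1 : 'rV[R]_n) != 0.
    apply/eqP => /rowP/(_ (Ordinal n0)); rewrite !mxE => /eqP.
    by rewrite oner_eq0.
  by eexists; exact: normalize dn0.
pose f v := mxform S' v v / mxform S v v.
have [|u /set_mem u1 umin] := EVT_min_rV (f := f) sphere0 compact_sphere.
  move=> v; apply: continuous_in_subspaceT => {}v /set_mem v1.
  have Sv0 : mxform S v v != 0 by rewrite gt_eqF// Spos// neq0.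
  have cS' := @mxform_continuous n S' v.
  exact: (cvgM cS' (cvgV Sv0 (@mxform_continuous n S v))).
have un0 := neq0 _ u1.
exists (f u), u; split=> //.
- by rewrite divr_gt0 ?Spos ?S'pos.
- by rewrite divfK// gt_eqF// Spos.
- move=> v; have [->|vn0] := eqVneq v 0.
    by rewrite -(scale0r (0 : 'rV[R]_n)) !Z expr0n !mul0r mulr0.
  have := umin _ (mem_set (normalize _ vn0)).
  rewrite -[leRHS]/(f _) {2}/f !Z -mulf_div divff ?mul1r; last first.
    rewrite expf_eq0/= invr_eq0 sqrtr_eq0 -ltNge lt_neqAle sqnorm_ge0 andbT.
    by apply: contra vn0 => /eqP sv; rewrite (@sqnorm_le0 _ _ v)// -sv.
  by rewrite ler_pdivlMr// Spos.
Qed.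

Lemma gram_mxform K n (f : {linear 'rV[R]_n -> L}) kappa :
  range f = K -> invariant_scalar_product_on K kappa ->
  forall u v, kappa (f u) (f v) =
    mxform (\matrix_(i, j) kappa (f (delta_mx 0 i)) (f (delta_mx 0 j))) u v.
Proof.
move=> fK [lin sym _ _] u v; have Kf w : K (f w) by rewrite -fK; exists w.
have slin z : scalar (fun w => kappa (f w) (f z)).
  by move=> a w w'; rewrite linearP lin.
rewrite (rV_functional_sum (slin v)) mxformE; apply: eq_bigr => i _.
rewrite sym// (rV_functional_sum (slin _)) mulr_sumr; apply: eq_bigr => j _.
by rewrite mxE sym//; ring.
Qed.

(** The difference of kappa' and c kappa, with c the minimal ratio, is positive
    semidefinite with a nonzero isotropic vector. *)
Lemma invariant_scalar_product_on_unique K n (f : {linear 'rV[R]_n -> L})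
    kappa kappa' : injective f -> range f = K -> lie_subalgebra K ->
  simple_lie K -> invariant_scalar_product_on K kappa ->
  invariant_scalar_product_on K kappa' ->
  exists2 c, 0 < c & forall x y, K x -> K y -> kappa' x y = c * kappa x y.
Proof.
move=> finj fK Kalg Ksimple kK kK'.
have Kf w : K (f w) by rewrite -fK; exists w.
have fn0 v : v != 0 -> f v != 0.
  by apply: contra => /eqP fv; apply/eqP/finj; rewrite fv linear0.
have [lin sym pos inv] := kK; have [lin' sym' pos' inv'] := kK'.
have n0 : (0 < n)%N.
  have [[x [y [Kx Ky xy0]]] _] := Ksimple.
  case: n f finj fK {Kf fn0} => // f _ fK; exfalso; apply: xy0.
  by move: Kx; rewrite -fK => -[v _ <-]; rewrite (thinmx0 v) linear0 lie0l.
set S := \matrix_(i, j) kappa (f (delta_mx 0 i)) (f (delta_mx 0 j)).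
set S' := \matrix_(i, j) kappa' (f (delta_mx 0 i)) (f (delta_mx 0 j)).
have SE u v : mxform S u v = kappa (f u) (f v) by rewrite (gram_mxform fK kK).
have S'E u v : mxform S' u v = kappa' (f u) (f v).
  by rewrite (gram_mxform fK kK').
have [||c [u [c0 un0 cu cmin]]] := @mxform_ratio_min n S S' n0.
- by move=> v vn0; rewrite SE pos// fn0.
- by move=> v vn0; rewrite S'E pos'// fn0.
exists c => // x y Kx Ky; apply/eqP; rewrite -subr_eq0; apply/eqP.
apply: (@psd_invariant_form_radical K (fun x y => kappa' x y - c * kappa x y)
  (f u)) => //.
- by move=> a x1 x2 x3 Kx1 Kx2 Kx3; rewrite lin// lin'//; ring.
- by move=> x1 x2 Kx1 Kx2; rewrite sym// sym'.
- move=> x1; rewrite -fK => -[v _ <-]; rewrite subr_ge0.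
  by have := cmin v; rewrite SE S'E.
- by move=> x1 x2 x3 Kx1 Kx2 Kx3; rewrite inv// inv'.
- exact: fn0.
- by have := cu; rewrite SE S'E => ->; rewrite subrr.
Qed.

Lemma compact_simple_lie_scalar_product K : compact_simple_lie K ->
  exists kappa, invariant_scalar_product_on K kappa.
Proof.
by move=> [_ _ _ [n [G [cG]]]]; exact: compact_lie_invariant_scalar_product.
Qed.

Lemma compact_simple_lie_scalar_product_unique K kappa kappa' :
  compact_simple_lie K -> invariant_scalar_product_on K kappa ->
  invariant_scalar_product_on K kappa' ->
  exists2 c, 0 < c & forall x y, K x -> K y -> kappa' x y = c * kappa x y.
Proof.
move=> [Kalg _ Ksimple [n [G [_ [c [_ _ [f [finj fK _]]]]]]]].
exact: (invariant_scalar_product_on_unique finj fK Kalg Ksimple).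
Qed.

End FormsOnSubspaces.

(** * Directed unions *)

Theorem proposition6p7 (R : realType) (g : lieAlgType R)
    (g_locally_finite : locally_finite_lie g)
    (g_directed_union : directed_union_of (@compact_simple_lie R g)) :
  exists kappa : g -> g -> R,
    invariant_scalar_product kappa /\
    forall kappa' : g -> g -> R, invariant_scalar_product kappa' ->
      exists c : R, 0 < c /\ forall x y : g, kappa' x y = c * kappa x y.
Proof.
have [F [[K0 FK0] Fcs Fdir Fcover]] := g_directed_union.
have [x0 Kx0 x0n0] : exists2 x, K0 x & x != 0.
  have [_ _ [[x [y [Kx _ xy0]]] _] _] := Fcs _ FK0; exists x => //.
  by apply/eqP => x0; apply: xy0; rewrite x0 lie0l.
(* Only the members above K0 are used: they contain the normalising vector. *)
pose good K := F K /\ K0 `<=` K.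
have /choice[k kP] : forall K : set g, exists kappa : g -> g -> R, good K ->
    invariant_scalar_product_on K kappa /\ kappa x0 x0 = 1.
  move=> K; have [[FK K0K]|ngK] := pselect (good K); last first.
    by exists (fun _ _ => 0).
  have [kappa kK] := compact_simple_lie_scalar_product (Fcs _ FK).
  have k0 : 0 < kappa x0 x0 by case: kK => _ _ pos _; exact: pos (K0K _ Kx0) x0n0.
  exists (fun x y => (kappa x0 x0)^-1 * kappa x y) => _; split.
    by apply: invariant_scalar_product_onZ => //; rewrite invr_gt0.
  by rewrite mulVf// gt_eqF.
have kuniq K kappa : good K -> invariant_scalar_product_on K kappa ->
    forall x y, K x -> K y -> kappa x y = kappa x0 x0 * k K x y.
  move=> gK kappaK; have [kK k1] := kP _ gK.
  have [c _ kc] :=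
    compact_simple_lie_scalar_product_unique (Fcs _ gK.1) kK kappaK.
  by move=> x y Kx Ky; rewrite !kc ?k1 ?mulr1//; exact: gK.2.
have kcompat K K' : good K -> good K' -> K `<=` K' ->
    forall x y, K x -> K y -> k K' x y = k K x y.
  move=> gK gK' KK' x y Kx Ky; have [kK' k1] := kP _ gK'.
  by rewrite (kuniq K (k K') gK)// ?k1 ?mul1r//;
    exact: invariant_scalar_product_on_sub kK'.
have join K K' : good K -> F K' ->
    exists2 K'', good K'' & K `<=` K'' /\ K' `<=` K''.
  move=> [FK K0K] FK'; have [K'' FK'' [KK'' K'K'']] := Fdir _ _ FK FK'.
  by exists K'' => //; split=> //; exact: subset_trans KK''.
have cover2 x y : exists K, [/\ good K, K x & K y].
  have inF z : exists2 K, F K & K z.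
    by have : [set: g] z by []; rewrite -Fcover => -[K FK Kz]; exists K.
  have [[K1 F1 K1x] [K2 F2 K2y]] := (inF x, inF y).
  have [K3 g3 [_ K13]] := join K0 K1 (conj FK0 (@subset_refl _ K0)) F1.
  have [K4 g4 [K34 K24]] := join K3 K2 g3 F2.
  by exists K4; split; [|exact/K34/K13|exact: K24].
have cover3 x y z : exists K, [/\ good K, K x, K y & K z].
  have [K [gK Kx Ky]] := cover2 x y; have [K' [gK' Kz _]] := cover2 z z.
  have [K'' gK'' [KK'' K'K'']] := join K K' gK gK'.1.
  by exists K''; split=> //; [exact: KK''|exact: KK''|exact: K'K''].
have /choice[E EP] : forall p : g * g, exists K, [/\ good K, K p.1 & K p.2].
  by move=> [x y]; exact: cover2.
pose kappa x y := k (E (x, y)) x y.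
have kappaE K x y : good K -> K x -> K y -> kappa x y = k K x y.
  move=> gK Kx Ky; have [gE Ex Ey] := EP (x, y).
  have [K' gK' [KK' EK']] := join K _ gK gE.1.
  by rewrite /kappa -(kcompat _ _ gE gK' EK')// (kcompat _ _ gK gK' KK').
have kappa_lin x y z a : kappa (a *: x + y) z = a * kappa x z + kappa y z.
  have [K [gK Kx Ky Kz]] := cover3 x y z.
  have [[lin _ _ _] _] := kP _ gK.
  have [[[_ Klin] _] _ _ _] := Fcs _ gK.1.
  by rewrite !(kappaE K)// ?lin//; exact: Klin.
have kappa_sym x y : kappa x y = kappa y x.
  have [K [gK Kx Ky]] := cover2 x y; have [[_ sym _ _] _] := kP _ gK.
  by rewrite !(kappaE K)// sym.
exists kappa; split.
  split=> // [|x xn0|x y z].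
  - split=> [x a y z|y a x z]; last exact: kappa_lin.
    by rewrite /= (kappa_sym x (_ + _)) kappa_lin (kappa_sym x y) (kappa_sym x z).
  - have [K [gK Kx _]] := cover2 x x; have [[_ _ pos _] _] := kP _ gK.
    by rewrite (kappaE K)// pos.
  - have [K [gK Kx Ky Kz]] := cover3 x y z; have [[_ _ _ inv] _] := kP _ gK.
    have [[_ Klie] _ _ _] := Fcs _ gK.1.
    by rewrite !(kappaE K)// ?inv//; exact: Klie.
move=> kappa' kappa'P; exists (kappa' x0 x0); split.
  by case: kappa'P => _ _ pos _; exact: pos.
move=> x y; have [K [gK Kx Ky]] := cover2 x y; rewrite (kappaE K)//.
by apply: kuniq => //; exact: invariant_scalar_product_restrict.
Qed.
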